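(* Let $J=2$ and let $\{(d_i,n_i,0),i=1,2,3\}$ be the $2$-dimensional GPS ESP, so that $G=\mathbb{R}^2_+$. Then there exist a continuous function $\psi:[0,\infty)\to\mathbb{R}^2$ with $\psi(0)\in G$ and a pair $(\phi,\eta)$ that solves the ESP for $\psi$ such that $|\eta|(\tau_0)=\infty$, where $\tau_0=\inf\{t\ge0:\phi(t)=0\}$.
   Context: $|\eta|(t)$ denotes the total variation of $\eta$ on $[0,t]$. $2$-dimensional GPS ESP (the data does not depend on the choice of weight vector when $J=2$): $n_1=(1,0)$, $d_1=(1,-1)$, $n_2=(0,1)$, $d_2=(-1,1)$, $n_3=d_3=(1,1)/\sqrt2$. The domain is $G=\mathbb{R}^2_+=\cap_{i=1}^3\{x:\langle x,n_i\rangle\ge0\}$; $d(x)=\{0\}$ for $x\in G^\circ$ and $d(x)=\{\sum_{i\in I(x)}\alpha_id_i:\alpha_i\ge0\}$ for $x\in\partial G$, where $I(x)=\{i\in\{1,2,3\}:\langle x,n_i\rangle=0\}$. Given $\psi$ right-continuous with left limits and $\psi(0)\in G$, a pair $(\phi,\eta)$ of $\mathbb{R}^2$-valued right-continuous functions with left limits on $[0,\infty)$ solves the ESP for $\psi$ if $\phi(0)=\psi(0)$ and for all $t\ge0$: $\phi(t)=\psi(t)+\eta(t)$; $\phi(t)\in G$; $\eta(t)-\eta(s)\in\overline{\mathrm{co}}[\cup_{u\in(s,t]}d(\phi(u))]$ for every $s\in[0,t]$; and $\eta(t)-\eta(t-)\in\overline{\mathrm{co}}[d(\phi(t))]$, where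 $\overline{\mathrm{co}}$ is the closed convex hull. *)

(* Defs.v *)
From mathcomp Require Import all_boot all_order all_algebra.
From mathcomp Require Import all_classical all_reals all_analysis.

Set Implicit Arguments.
Unset Strict Implicit.
Unset Printing Implicit Defensive.

Import Order.TTheory GRing.Theory Num.Theory.
Import numFieldNormedType.Exports.

Local Open Scope classical_set_scope.
Local Open Scope ring_scope.

Definition inner (R : realType) (J : nat) (u v : 'rV[R]_J) : R :=
  \sum_(j < J) u 0 j * v 0 j.

(* The library norm on 'rV[R]_J is the sup norm; it induces the same topology,
   but total variation is measured here with the Euclidean norm. *)
Definition enorm (R : realType) (J : nat) (u : 'rV[R]_J) : R :=
  Num.sqrt (inner u u).

(* Vector-valued counterparts of [variation] and [total_variation], which the
   library has for real-valued functions only. *)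
Definition vvariation (R : realType) (J : nat) (a b : R) (f : R -> 'rV[R]_J)
    (s : seq R) : R :=
  let F := f \o nth b (a :: s) in
  \sum_(0 <= k < size s) enorm (F k.+1 - F k).

Definition vtotal_variation (R : realType) (J : nat) (a b : R)
    (f : R -> 'rV[R]_J) : \bar R :=
  ereal_sup [set (vvariation a b f s)%:E | s in itv_partition a b].

Definition closed_convex_hull (R : realType) (J : nat) (A : set 'rV[R]_J) :
    set 'rV[R]_J :=
  smallest [set B : set 'rV[R]_J |
    closed B /\ convex_set (B : set (convex_lmodType 'rV[R]_J))] A.

(* Functions on [0, oo[ are represented by functions on R of which only the
   restriction to [0, oo[ matters. *)
Definition cadlag (R : realType) (J : nat) (f : R -> 'rV[R]_J) : Prop :=
  (forall t : R, 0 <= t -> f u @[u --> t^'+] --> f t) /\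
  (forall t : R, 0 < t -> cvg (f u @[u --> t^'-])).

(* f(t-), with the convention f(0-) = f(0). *)
Definition left_limit (R : realType) (J : nat) (f : R -> 'rV[R]_J) (t : R) :
    'rV[R]_J :=
  if t == 0 then f 0 else lim (f u @[u --> t^'-]).

Definition esp_domain (R : realType) (J : nat) (I : finType)
    (n : I -> 'rV[R]_J) : set 'rV[R]_J :=
  \bigcap_(i in [set: I]) [set x | 0 <= inner x (n i)].

(* The direction field d(x) attached to normals n and directions d; it is only
   meaningful (and nonempty) on the domain. *)
Definition esp_dir (R : realType) (J : nat) (I : finType)
    (n d : I -> 'rV[R]_J) (x : 'rV[R]_J) : set 'rV[R]_J :=
  let G := esp_domain n in
  [set v | (interior G x /\ v = 0) \/
           ((closure G `\` interior G) x /\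
            exists a : I -> R, (forall i, 0 <= a i) /\
              v = \sum_(i | inner x (n i) == 0) a i *: d i)].

(* In the third condition the case s = t, where the increment is 0 and the union
   is empty, is left out: it would otherwise ask that 0 belong to the hull of the
   empty set. *)
Definition solves_ESP (R : realType) (J : nat) (I : finType)
    (n d : I -> 'rV[R]_J) (psi phi eta : R -> 'rV[R]_J) : Prop :=
  [/\ cadlag phi, cadlag eta, phi 0 = psi 0 &
    forall t : R, 0 <= t ->
      [/\ phi t = psi t + eta t,
          esp_domain n (phi t),
          forall s : R, 0 <= s -> s < t ->
            closed_convex_hull (\bigcup_(u in `]s, t]) esp_dir n d (phi u))
              (eta t - eta s) &
          closed_convex_hull (esp_dir n d (phi t)) (eta t - left_limit eta t)]].

Definition vec2 (R : realType) (a b : R) : 'rV[R]_2 :=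
  \row_(j < 2) (if j == 0 then a else b).

(* Index i = 0, 1, 2 of 'I_3 stands for 1, 2, 3. *)
Definition gps_normal (R : realType) (i : 'I_3) : 'rV[R]_2 :=
  match val i with
  | 0%N => vec2 1 0
  | 1%N => vec2 0 1
  | _ => (Num.sqrt 2)^-1 *: vec2 1 1
  end.

Definition gps_dir (R : realType) (i : 'I_3) : 'rV[R]_2 :=
  match val i with
  | 0%N => vec2 1 (- 1)
  | 1%N => vec2 (- 1) 1
  | _ => (Num.sqrt 2)^-1 *: vec2 1 1
  end.

Lemma gps_domainE (R : realType) :
  esp_domain (@gps_normal R) = [set x | forall j : 'I_2, 0 <= x 0 j].
Proof.
have E (x : 'rV[R]_2) (a b : R) : inner x (vec2 a b) = x 0 0 * a + x 0 1 * b.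
  by rewrite /inner !big_ord_recl big_ord0 !mxE addr0 /=; congr (_ + x 0 _ * _); exact/val_inj.
apply/seteqP; split => x /=.
  move=> Gx; have := Gx (inord 0) I; have := Gx (inord 1) I.
  rewrite /= /gps_normal /= !inordK // !E !(mulr1, mulr0, addr0, add0r) => h1 h0.
  by case=> -[|[|//]] p; [move: h0|move: h1]; congr (0 <= x 0 _); exact/val_inj.
move=> xge0 i _ /=; have s0 : 0 <= (Num.sqrt (2 : R))^-1 by rewrite invr_ge0 sqrtr_ge0.
have EZ c : inner x (c *: vec2 1 1) = c * inner x (vec2 1 1).
  by rewrite /inner mulr_sumr; apply: eq_bigr => j _; rewrite !mxE mulrCA.
rewrite /gps_normal; case: (val i) => [|[|k]];
  rewrite ?EZ !E !(mulr1, mulr0, addr0, add0r) //.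
by rewrite mulr_ge0 // addr_ge0.
Qed.

(* The infimum of the empty set is +oo. *)
Definition hitting_time0 (R : realType) (J : nat) (phi : R -> 'rV[R]_J) :
    \bar R :=
  ereal_inf [set t%:E | t in [set t : R | 0 <= t /\ phi t = 0]].

(* Main.v *)
Require Import Defs.
From mathcomp Require Import all_boot all_order all_algebra.
From mathcomp Require Import all_classical all_reals all_analysis.
From mathcomp Require Import ring lra.
Import Order.TTheory GRing.Theory Num.Theory.
Import numFieldNormedType.Exports.
Local Open Scope classical_set_scope.
Local Open Scope ring_scope.

(** The idea is to let the constraining term move along a single line,
    eta(t) = (g(t) - g(0)) * (1, -1), and to make the path phi visit the two axes
    alternately before reaching the origin at time 1.  On the axis x = 0 the
    direction (1, -1) is available, so g may increase there; on the axis y = 0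
    the direction (-1, 1) is available, so g may decrease there.  If the n-th
    visit moves g by an amount of order 1/n, with alternating signs, then g has a
    limit at time 1 although its total variation dominates the harmonic series.
    With phi and eta continuous, psi := phi - eta is continuous too.

    The construction is carried out in the variable z = (1 - t)^-1, in which
    time 1 lies at infinity.  A staircase [stair a] passes from a(n) to a(n+1)
    during [n, n + 1/2] and rests until n + 1.  The function g is the staircase
    of the alternating sequence [zigzag], read at z; it is called [push] below.
    Before time 1, phi = (1 - t) * (p, 1 - p) where p is the staircase of
    0, 1, 0, 1, ..., delayed by 1/2: p rests while g moves, so that phi sits on
    the right axis at that time.
    Since |g| <= 1/z and phi = O(1/z), both extend continuously by 0 beyond
    time 1 ([compress_continuous]).

    Increments are controlled by a single time each: if g(s) < g(t), then phi
    meets the axis x = 0 somewhere in (s, t] ([push_rise_x0]), and the whole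
    increment is a multiple of the direction there; the same holds with
    the axes exchanged when g(t) < g(s) ([push_fall_y0]).  For t >= 1 the point
    phi(t) = 0 lies on both axes and either direction is available. *)

(** * Staircase functions *)

Definition ramp {R : realType} (z : R) : R := Num.min 1 (Num.max 0 (2 * z)).

Lemma ramp0 {R : realType} (z : R) : z <= 0 -> ramp z = 0.
Proof.
by move=> z0; rewrite /ramp max_l ?min_r ?ler01// mulr_ge0_le0.
Qed.

Lemma ramp1 {R : realType} (z : R) : 1 / 2 <= z -> ramp z = 1.
Proof. by move=> z1; rewrite /ramp min_l// le_max; apply/orP; right; lra. Qed.

Lemma ramp_itv {R : realType} (z : R) : 0 <= ramp z <= 1.
Proof. by rewrite /ramp ge_min lexx /= le_min ler01 le_max lexx. Qed.

Lemma ramp_homo {R : realType} (y z : R) : y <= z -> ramp y <= ramp z.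
Proof.
move=> yz; rewrite /ramp; apply: le_min2; rewrite ?lexx//.
by apply: le_max2; rewrite ?lexx// ler_pM2l.
Qed.

Lemma ramp_continuous {R : realType} : continuous (@ramp R).
Proof.
move=> z; apply: (@continuous_min R R (cst 1) (fun y => Num.max 0 (2 * y))).
  exact: cvg_cst.
apply: (@continuous_max R R (cst 0) (fun y => 2 * y)); first exact: cvg_cst.
by apply: cvgM; [exact: cvg_cst|exact: cvg_id].
Qed.

Definition partial_stair {R : realType} (a : nat -> R) (N : nat) (z : R) : R :=
  a 0 + \sum_(0 <= k < N) (a k.+1 - a k) * ramp (z - k%:R).

(** The infinite sum of the increments is cut at the last index that can
    contribute, since [ramp] vanishes on the negative axis; any later cut gives
    the same value ([stairE]), which makes the function locally a fixed finite
    sum. *)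
Definition stair {R : realType} (a : nat -> R) (z : R) : R :=
  partial_stair a (Num.trunc z).+1 z.

Lemma partial_stair_stable {R : realType} (a : nat -> R) (M N : nat) (z : R) :
  (M <= N)%N -> z <= M%:R -> partial_stair a N z = partial_stair a M z.
Proof.
move=> MN zM; rewrite /partial_stair (@big_cat_nat _ _ _ M 0 N)//=.
rewrite [X in _ + (_ + X)]big_nat [X in _ + (_ + X)]big1 ?addr0// => k /andP[Mk _].
rewrite ramp0 ?mulr0// subr_le0 (le_trans zM)// ler_nat//.
Qed.

Lemma stairE {R : realType} (a : nat -> R) (N : nat) (z : R) :
  z <= N%:R -> stair a z = partial_stair a N z.
Proof.
move=> zN; rewrite /stair; have zt := ltW (truncnS_gt z).
case: (leqP (Num.trunc z).+1 N) => [h|/ltnW h].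
  by rewrite (@partial_stair_stable _ _ _ N z h zt).
by rewrite (@partial_stair_stable _ _ _ _ z h zN).
Qed.

Lemma partial_stair_last {R : realType} (a : nat -> R) (n : nat) (z : R) :
  n%:R - 1 / 2 <= z -> partial_stair a n z = a n.
Proof.
move=> nz; rewrite /partial_stair.
rewrite (@eq_big_nat _ _ _ 0 n _ (fun k => a k.+1 - a k)); last first.
  move=> k /andP[_ kn]; rewrite ramp1 ?mulr1//.
  have : (k.+1%:R : R) <= n%:R by rewrite ler_nat.
  rewrite -natr1; lra.
by rewrite telescope_sumr// addrC subrK.
Qed.

(** All the steps before n are completed by n - 1/2, and the step from n has not
    started at n. *)
Lemma stair_plateau {R : realType} (a : nat -> R) (n : nat) (z : R) :
  n%:R - 1 / 2 <= z <= n%:R -> stair a z = a n.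
Proof. by case/andP=> z1 z2; rewrite (@stairE _ _ n)// partial_stair_last. Qed.

Lemma stair_nat {R : realType} (a : nat -> R) (n : nat) : stair a n%:R = a n.
Proof. by apply: stair_plateau; lra. Qed.

(** At each point only one step is in progress. *)
Lemma stair_convex {R : realType} (a : nat -> R) (z : R) :
  exists2 l : R, 0 <= l <= 1 &
    stair a z = (1 - l) * a (Num.trunc z) + l * a (Num.trunc z).+1.
Proof.
exists (ramp (z - (Num.trunc z)%:R)); first exact: ramp_itv.
rewrite /stair /partial_stair big_nat_recr//= addrA -/(partial_stair a _ z).
have -> : partial_stair a (Num.trunc z) z = a (Num.trunc z); last by ring.
have [z0|z0] := leP 0 z; last first.
  have -> : Num.trunc z = 0%N.
    by apply/truncn0Pn; rewrite -ltNge (lt_trans z0).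
  by rewrite /partial_stair big_geq// addr0.
apply: partial_stair_last; have := z0; rewrite -truncn_le; lra.
Qed.

Lemma stairN {R : realType} (a : nat -> R) (z : R) :
  stair (fun k => - a k) z = - stair a z.
Proof.
rewrite /stair /partial_stair opprD -sumrN; congr (_ + _).
by apply: eq_bigr => k _; ring.
Qed.

(** An increment is a sum over the steps, so some upward step must be in progress
    at some moment between the two arguments. *)
Lemma stair_rise {R : realType} {a : nat -> R} {y z : R} :
  y < z -> stair a y < stair a z ->
  exists n : nat, a n < a n.+1 /\
    exists2 u : R, y < u <= z & n%:R <= u <= n%:R + 1 / 2.
Proof.
move=> yz; pose N := (Num.trunc z).+1.
have zN : z <= N%:R := ltW (truncnS_gt z).
rewrite (@stairE _ _ N _ zN) (@stairE _ _ N); last exact: le_trans (ltW yz) zN.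
rewrite /partial_stair ltrD2l; apply: contraPP => /forallNP no.
apply/negP; rewrite -leNgt; apply: ler_sum_nat => k _.
have [ak|ak] := leP (a k.+1) (a k).
  by apply: ler_wnM2l; [lra | apply: ramp_homo; lra].
have {no} no := no k; suff -> : ramp (z - k%:R) = ramp (y - k%:R) by [].
have [yk|yk] := leP (k%:R + 1 / 2) y.
  by rewrite !ramp1//; lra.
have [zk|zk] := leP z k%:R; first by rewrite !ramp0//; lra.
exfalso; apply: no; split => //.
(* the last moment of the step from k that does not exceed z *)
exists (Num.min z (k%:R + 1 / 2)).
  by rewrite lt_min yz yk ge_min lexx.
by rewrite le_min (ltW zk) ge_min lexx orbT /= andbT; lra.
Qed.

Lemma stair_continuous {R : realType} (a : nat -> R) : continuous (stair a).
Proof.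
move=> z; pose N := (Num.trunc z).+1.
have zN : z < N%:R := truncnS_gt z.
rewrite /continuous_at (@stairE _ _ N z (ltW zN)).
apply: cvg_trans (_ : partial_stair a N y @[y --> z] --> _).
  apply: near_eq_cvg; near=> y; symmetry; apply: stairE; apply: ltW.
  near: y; exact: lt_nbhsl.
apply: cvgD; first exact: cvg_cst.
apply: (cvg_big add_continuous) => k _; apply: cvgM; first exact: cvg_cst.
apply: (@cvg_comp _ _ _ (fun y => y - k%:R) (@ramp R) _ (nbhs (z - k%:R))).
  by apply: cvgB; [exact: cvg_id|exact: cvg_cst].
exact: ramp_continuous.
Unshelve. all: by end_near. Qed.

(** * Compressing a half-line into [0, 1) *)

Definition compress {R : realType} (f : R -> R) (t : R) : R :=
  if t < 1 then f (1 - t)^-1 else 0.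

(** The bound by z^-1 turns into |1 - t|, which squeezes the function to 0 at
    time 1. *)
Lemma compress_continuous {R : realType} (f : R -> R) :
  (forall z : R, 0 < z -> f y @[y --> z] --> f z) ->
  (forall z : R, 0 < z -> `|f z| <= z^-1) ->
  continuous (compress f).
Proof.
move=> fc fb t; rewrite /continuous_at.
have sub_cvg (c s : R) : c - u @[u --> s] --> c - s.
  by apply: cvgB; [exact: cvg_cst|exact: cvg_id].
have [t1|t1|->] := ltgtP t 1.
- apply: cvg_trans (_ : f (1 - u)^-1 @[u --> t] --> _).
    apply: near_eq_cvg; near=> u; rewrite /compress ifT//.
    near: u; exact: lt_nbhsl.
  rewrite /compress t1.
  apply: (@cvg_comp _ _ _ (fun u => (1 - u)^-1) f _ (nbhs (1 - t)^-1)); last first.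
    by apply: fc; rewrite invr_gt0 subr_gt0.
  by apply: cvgV; [rewrite subr_eq0 gt_eqF|exact: sub_cvg].
- rewrite {2}/compress ltNge (ltW t1) /=.
  apply: cvg_trans (_ : cst (0 : R) u @[u --> t] --> _); last exact: cvg_cst.
  apply: near_eq_cvg; near=> u.
  rewrite /compress ltNge ifN// negbK; apply: ltW.
  near: u; exact: lt_nbhsr.
- rewrite {2}/compress ltxx; apply: norm_cvg0.
  apply: (@squeeze_cvgr _ _ _ _ (cst 0) (fun u => `|1 - u|)).
  + near=> u; rewrite normr_ge0 /=; rewrite /compress.
    case: ifPn => u1; last by rewrite normr0.
    rewrite (le_trans (fb _ _)) ?invr_gt0 ?subr_gt0// invrK.
    exact: ler_norm.
  + exact: cvg_cst.
  + have h := cvg_norm (sub_cvg 1 1); rewrite subrr normr0 in h; exact: h.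
Unshelve. all: by end_near. Qed.

(** * Extended Skorokhod problems with continuous paths *)

Lemma vec2E {R : realType} (a b : R) :
  vec2 a b = a *: vec2 1 0 + b *: vec2 0 1.
Proof.
by apply/rowP => j; rewrite !mxE; case: ifP => _; rewrite mulr0 mulr1 ?addr0 ?add0r.
Qed.

Lemma inner_vec2 {R : realType} (a b c d : R) :
  inner (vec2 a b) (vec2 c d) = a * c + b * d.
Proof. by rewrite /inner !big_ord_recl big_ord0 !mxE addr0. Qed.

Lemma vec2_continuous {R : realType} (f g : R -> R) :
  continuous f -> continuous g -> continuous (fun t => vec2 (f t) (g t)).
Proof.
move=> fc gc t; rewrite /continuous_at; under eq_fun do rewrite vec2E.
by rewrite vec2E; apply: cvgD; apply: cvgZr_tmp; [exact: fc|exact: gc].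
Qed.

Lemma esp_dir0 {R : realType} (J : nat) (K : finType) (n d : K -> 'rV[R]_J)
    (x : 'rV[R]_J) : esp_domain n x -> esp_dir n d x 0.
Proof.
move=> Gx; have [ix|ix] := pselect (interior (esp_domain n) x); first by left.
right; split; first by split => //; exact: subset_closure.
by exists (fun=> 0); split => //; rewrite big1// => i _; rewrite scale0r.
Qed.

(** Moving from x against the normal of a face that contains x leaves the
    domain at once. *)
Lemma face_notin_interior {R : realType} (J : nat) (K : finType)
    (n : K -> 'rV[R]_J) (x : 'rV[R]_J) (i : K) :
  inner x (n i) = 0 -> 0 < inner (n i) (n i) -> ~ interior (esp_domain n) x.
Proof.
move=> xi ni0 ix.
have shift : x - e *: n i @[e --> (0 : R)] --> x.
  have : x - e *: n i @[e --> (0 : R)] --> x - 0 *: n i.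
    by apply: cvgB; [exact: cvg_cst|apply: cvgZr_tmp; exact: cvg_id].
  by rewrite scale0r subr0.
have inG : \forall e \near (0 : R)^'+, esp_domain n (x - e *: n i).
  exact: (cvg_at_right_filter shift ix).
have [e [/= e0 eG]] :
    exists e : R, 0 < e /\ esp_domain n (x - e *: n i).
  by near (0 : R)^'+ => e; exists e; split; near: e => //; exact: nbhs_right_gt.
have /= := eG i I.
have -> /= : inner (x - e *: n i) (n i) = inner x (n i) - e * inner (n i) (n i).
  rewrite /inner mulr_sumr -sumrB; apply: eq_bigr => j _; rewrite !mxE; ring.
by rewrite xi sub0r oppr_ge0 leNgt mulr_gt0.
Unshelve. all: by end_near. Qed.

Lemma esp_dir_face {R : realType} (J : nat) (K : finType) (n d : K -> 'rV[R]_J)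
    (x : 'rV[R]_J) (i : K) (c : R) :
  esp_domain n x -> inner x (n i) = 0 -> 0 < inner (n i) (n i) -> 0 <= c ->
  esp_dir n d x (c *: d i).
Proof.
move=> Gx xi ni0 c0; right; split.
  by split; [exact: subset_closure|exact: face_notin_interior ni0].
exists (fun k => if k == i then c else 0); split; first by move=> k; case: ifP.
rewrite (bigD1 i)/= ?xi// eqxx big1 ?addr0// => k /andP[_ /negbTE ->].
by rewrite scale0r.
Qed.

Lemma continuous_cadlag {R : realType} (J : nat) (f : R -> 'rV[R]_J) :
  continuous f -> cadlag f.
Proof.
move=> fc; split=> t _; first exact/cvg_at_right_filter/fc.
by apply/cvg_ex; exists (f t); exact/cvg_at_left_filter/fc.
Qed.

Lemma continuous_left_limit {R : realType} (J : nat) (f : R -> 'rV[R]_J) (t : R) :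
  continuous f -> left_limit f t = f t.
Proof.
move=> fc; rewrite /left_limit; case: ifPn => [/eqP ->//|_].
apply: cvg_lim; first exact: norm_hausdorff.
exact/cvg_at_left_filter/fc.
Qed.

(** A continuous eta has jump 0, which is admissible at every point of the domain,
    and an increment is placed in the hull by one time at which it is an
    admissible direction. *)
Lemma continuous_solves_ESP {R : realType} (J : nat) (K : finType)
    (n d : K -> 'rV[R]_J) (phi eta : R -> 'rV[R]_J) :
  continuous phi -> continuous eta -> eta 0 = 0 ->
  (forall t, esp_domain n (phi t)) ->
  (forall s t : R, s < t ->
    exists2 u : R, s < u <= t & esp_dir n d (phi u) (eta t - eta s)) ->
  solves_ESP n d (phi \- eta) phi eta.
Proof.
move=> phic etac eta0 Gphi push.
split; [exact: continuous_cadlag|exact: continuous_cadlag|by rewrite /= eta0 subr0|].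
move=> t _; split; [by rewrite /= subrK|exact: Gphi| |].
  move=> s _ st; apply: sub_gen_smallest.
  by have [u su du] := push s t st; exists u => //=; rewrite in_itv.
by rewrite continuous_left_limit// subrr; apply: sub_gen_smallest; exact: esp_dir0.
Qed.

(** * The oscillating path *)

Lemma compress_time {R : realType} (f : R -> R) (z : R) :
  0 < z -> compress f (1 - z^-1) = f z.
Proof.
move=> z0; rewrite /compress ifT ?gtrBl ?invr_gt0//.
by rewrite opprB addrC subrK invrK.
Qed.

Lemma compress_ge1 {R : realType} (f : R -> R) (t : R) :
  1 <= t -> compress f t = 0.
Proof. by rewrite /compress ltNge => ->. Qed.

(** The sign is chosen so that the steps from even indices go up; convergence to 0
    while the step sizes are not summable is what separates continuity from
    bounded variation. *)
Definition zigzag {R : realType} (n : nat) : R := (-1) ^+ n.+1 * harmonic n.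

(** The delay by 1/2 makes [swing] rest on [n, n + 1/2], the intervals on which a
    staircase without delay moves. *)
Definition swing {R : realType} (z : R) : R :=
  stair (fun n => (odd n)%:R) (z - 1 / 2).

Definition xpath {R : realType} : R -> R := compress (fun z => z^-1 * swing z).

Definition ypath {R : realType} : R -> R :=
  compress (fun z => z^-1 * (1 - swing z)).

Definition push {R : realType} : R -> R := compress (stair zigzag).

Lemma zigzag_rise {R : realType} (n : nat) :
  (zigzag n < zigzag n.+1 :> R) = ~~ odd n.
Proof.
have h0 := @harmonic_gt0 R n; have h1 := @harmonic_gt0 R n.+1.
rewrite /zigzag -signr_odd -[(-1) ^+ n.+2]signr_odd.
move: (harmonic n) (harmonic n.+1) h0 h1 => p q p0 q0 /=.
by case: (odd n); rewrite /= expr0 expr1; [apply/negbTE; rewrite -leNgt|apply/idP]; lra.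
Qed.

Lemma zigzag_step {R : realType} (n : nat) :
  harmonic n <= `|zigzag n.+1 - zigzag n| :> R.
Proof.
have h0 := @harmonic_ge0 R n; have h1 := @harmonic_ge0 R n.+1.
have -> : zigzag n.+1 - zigzag n = (-1) ^+ n.+2 * (harmonic n.+1 + harmonic n) :> R.
  by rewrite /zigzag [(-1) ^+ n.+2]exprS; ring.
rewrite normrM normrX normrN1 expr1n mul1r ger0_norm ?addr_ge0//.
by rewrite lerDr.
Qed.

(** On the n-th step |zigzag| is at most 1/(n+1), and z < n + 1 there. *)
Lemma stair_zigzag_le {R : realType} (z : R) :
  0 < z -> `|stair zigzag z| <= z^-1.
Proof.
move=> z0; have [l l01 ->] := stair_convex (@zigzag R) z.
set n := Num.trunc z.
have nz (m : nat) : `|zigzag m| = harmonic m :> R.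
  by rewrite normrM normrX normrN1 expr1n mul1r ger0_norm// harmonic_ge0.
have hn : harmonic n <= z^-1 :> R.
  by rewrite /harmonic lef_pV2 ?posrE ?ltr0n//; exact/ltW/truncnS_gt.
have hS : harmonic n.+1 <= harmonic n :> R.
  by rewrite /harmonic lef_pV2 ?posrE ?ltr0n// ler_nat.
rewrite (le_trans (ler_normD _ _))//.
rewrite [`|(1 - l) * _|]normrM [`|l * _|]normrM !nz !ger0_norm; nra.
Qed.

Lemma swing_itv {R : realType} (z : R) : 0 <= swing z <= 1.
Proof.
rewrite /swing; have [l l01 ->] := stair_convex (fun n => (odd n)%:R) (z - 1 / 2).
by rewrite /=; case: (odd _); rewrite /= ?mulr1 ?mulr0 ?addr0 ?add0r; lra.
Qed.

Lemma swing_cvg {R : realType} (z : R) : swing y @[y --> z] --> swing z.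
Proof.
apply: (@cvg_comp _ _ _ (fun y => y - 1 / 2)
  (stair (fun n => (odd n)%:R)) _ (nbhs (z - 1 / 2))).
  by apply: cvgB; [exact: cvg_id|exact: cvg_cst].
exact: stair_continuous.
Qed.

Lemma swing_plateau {R : realType} {n : nat} {z : R} :
  n%:R <= z <= n%:R + 1 / 2 -> swing z = (odd n)%:R.
Proof. by move=> nz; rewrite /swing (@stair_plateau _ _ n)//; lra. Qed.

Lemma push_continuous {R : realType} : continuous (@push R).
Proof.
apply: compress_continuous => z z0; [exact: stair_continuous|].
exact: stair_zigzag_le.
Qed.

Lemma xpath_continuous {R : realType} : continuous (@xpath R).
Proof.
apply: compress_continuous => z z0.
  apply: cvgM; last exact: swing_cvg.
  by apply: cvgV; [rewrite gt_eqF|exact: cvg_id].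
have /andP[s0 s1] := swing_itv z.
rewrite ger0_norm ?mulr_ge0 ?invr_ge0 ?(ltW z0)//.
by rewrite ler_piMr// invr_ge0 ltW.
Qed.

Lemma ypath_continuous {R : realType} : continuous (@ypath R).
Proof.
apply: compress_continuous => z z0.
  apply: cvgM; first by apply: cvgV; [rewrite gt_eqF|exact: cvg_id].
  by apply: cvgB; [exact: cvg_cst|exact: swing_cvg].
have /andP[s0 s1] := swing_itv z.
rewrite ger0_norm ?mulr_ge0 ?invr_ge0 ?subr_ge0 ?(ltW z0)//.
by rewrite ler_piMr ?invr_ge0 ?(ltW z0)// gerBl.
Qed.

Lemma xpath_ge0 {R : realType} (t : R) : 0 <= xpath t.
Proof.
rewrite /xpath /compress; case: ifP => // t1.
have /andP[s0 _] := swing_itv (1 - t)^-1.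
by rewrite invrK mulr_ge0// subr_ge0 ltW.
Qed.

Lemma ypath_ge0 {R : realType} (t : R) : 0 <= ypath t.
Proof.
rewrite /ypath /compress; case: ifP => // t1.
have /andP[_ s1] := swing_itv (1 - t)^-1.
by rewrite invrK mulr_ge0 ?subr_ge0// ltW.
Qed.

Lemma xpathDypath {R : realType} {t : R} : t < 1 -> xpath t + ypath t = 1 - t.
Proof. by move=> t1; rewrite /xpath /ypath /compress t1 invrK; ring. Qed.

(** This is [stair_rise] transported to the time scale of [compress]. *)
Lemma rise_hits_plateau {R : realType} {a : nat -> R} {s t : R} :
  s < t < 1 -> compress (stair a) s < compress (stair a) t ->
  exists n : nat, a n < a n.+1 /\
    exists2 z : R, 0 < z /\ s < 1 - z^-1 <= t & n%:R <= z <= n%:R + 1 / 2.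
Proof.
move=> /andP[st t1]; have s1 := lt_trans st t1.
have lt_st : (1 - s)^-1 < (1 - t)^-1.
  by rewrite ltf_pV2 ?posrE ?subr_gt0// ltrD2l ltrN2.
rewrite /compress s1 t1 => /(stair_rise lt_st)[n [an [z /andP[sz zt] nz]]].
exists n; split => //.
have s0 : 0 < (1 - s)^-1 by rewrite invr_gt0 subr_gt0.
have z0 := lt_trans s0 sz.
exists z => //; split => //; apply/andP; split.
  by rewrite ltrBrDl -ltrBrDr invf_plt ?posrE ?subr_gt0.
by rewrite lerBlDl -lerBlDr invf_pge ?posrE ?subr_gt0.
Qed.

(** Upward steps of [zigzag] leave from even indices, where [swing] rests at 0. *)
Lemma push_rise_x0 {R : realType} {s t : R} :
  s < t -> push s < push t -> exists2 u : R, s < u <= t & xpath u = 0.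
Proof.
move=> st; have [t1 _|t1] := leP 1 t.
  by exists t; rewrite ?st ?lexx//; exact: compress_ge1.
have st1 : s < t < 1 by rewrite st t1.
move=> /(rise_hits_plateau st1)[n []].
rewrite zigzag_rise => /negbTE en [z [z0 sz] nz]; exists (1 - z^-1) => //.
by rewrite /xpath compress_time// (swing_plateau nz) en mulr0.
Qed.

(** Downward steps leave from odd indices, where [swing] rests at 1; they are the
    upward steps of the opposite staircase. *)
Lemma push_fall_y0 {R : realType} {s t : R} :
  s < t -> push t < push s -> exists2 u : R, s < u <= t & ypath u = 0.
Proof.
move=> st; have [t1 _|t1] := leP 1 t.
  by exists t; rewrite ?st ?lexx//; exact: compress_ge1.
have st1 : s < t < 1 by rewrite st t1.
have pushN (u : R) : u < 1 -> compress (stair (fun n => - zigzag n)) u = - push u :> R.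
  by move=> u1; rewrite /push /compress u1 stairN.
rewrite -ltrN2 -!pushN ?(lt_trans st)//.
move=> /(rise_hits_plateau st1)[n []].
rewrite ltrN2 => /lt_gtF; rewrite zigzag_rise => /negbFE en [z [z0 sz] nz].
exists (1 - z^-1) => //.
by rewrite /ypath compress_time// (swing_plateau nz) en subrr mulr0.
Qed.

(** * Infinite variation *)

Lemma le_enorm_gps_dir {R : realType} (c : R) :
  `|c| <= enorm (c *: gps_dir R (ord0 : 'I_3)).
Proof.
have -> : c *: gps_dir R (ord0 : 'I_3) = vec2 c (- c).
  by apply/rowP => j; rewrite !mxE; case: ifP; rewrite ?mulr1 ?mulrN1.
rewrite /enorm inner_vec2 -sqrtr_sqr; apply: ler_wsqrtr.
by rewrite mulrNN expr2 lerDl -expr2 sqr_ge0.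
Qed.

(** The last interval of the partition, from t(N) to b, only adds to the sum. *)
Lemma vtotal_variation_ge_sum {R : realType} (J : nat) (a b : R)
    (f : R -> 'rV[R]_J) (t : nat -> R) (N : nat) :
  t 0 = a -> (forall k, t k < t k.+1) -> (forall k, t k < b) ->
  ((\sum_(0 <= k < N) enorm (f (t k.+1) - f (t k)))%:E
     <= vtotal_variation a b f)%E.
Proof.
move=> t0 tS tb; pose s := rcons (mkseq (fun k => t k.+1) N) b.
have ss : size s = N.+1 by rewrite size_rcons size_mkseq.
have s_nth k : (k <= N)%N -> nth b (a :: s) k = t k.
  case: k => [//|k kN] /=; by rewrite nth_rcons size_mkseq kN nth_mkseq.
have s_last : nth b (a :: s) N.+1 = b.
  by rewrite /= nth_rcons size_mkseq ltnn eqxx.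
have part : itv_partition a b s.
  split; last by rewrite /s last_rcons.
  apply/(pathP b) => i; rewrite ss ltnS leq_eqVlt => /orP[/eqP ->|iN].
    by rewrite s_nth// -[nth b s N]/(nth b (a :: s) N.+1) s_last.
  by rewrite -[nth b s i]/(nth b (a :: s) i.+1) !s_nth// ltnW.
apply: (@le_trans _ _ (vvariation a b f s)%:E); last first.
  by apply: ereal_sup_ubound; exists s.
rewrite lee_fin /vvariation ss big_nat_recr//=.
rewrite (@eq_big_nat _ _ _ 0 N _
  (fun k => enorm (f (nth b (a :: s) k.+1) - f (nth b (a :: s) k)))); last first.
  by move=> k /andP[_ kN]; rewrite !s_nth// ltnW.
by rewrite lerDl sqrtr_ge0.
Qed.

Lemma harmonic_tail_unbounded {R : realType} (A : R) :
  exists N : nat, A <= \sum_(0 <= k < N) harmonic k.+1.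
Proof.
apply: contrapT => /forallNP bdd; apply: (@dvg_harmonic R).
apply: nondecreasing_is_cvgn.
  apply/nondecreasing_seqP => n; rewrite !seriesEnat /= big_nat_recr//= lerDl.
  exact: harmonic_ge0.
exists (1 + Num.max A 0) => _ [[|n] _ <-]; rewrite seriesEnat.
  by rewrite /= big_geq// addr_ge0// le_max lexx orbT.
rewrite /= big_nat_recl//= invr1 lerD2l le_max; apply/orP; left.
by rewrite ltW// ltNge; apply/negP/bdd.
Qed.

(** The times at which z is an integer see the consecutive values of [zigzag]. *)
Lemma push_variation {R : realType} (c : R) :
  vtotal_variation 0 1 (fun t => (push t - c) *: gps_dir R (ord0 : 'I_3)) =
  +oo%E.
Proof.
apply/eqyP => A _; have [N AN] := harmonic_tail_unbounded A.
pose t k : R := 1 - k.+1%:R^-1.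
apply: le_trans (@vtotal_variation_ge_sum _ _ _ _ _ t N _ _ _).
- rewrite lee_fin (le_trans AN)//; apply: ler_sum_nat => k _.
  rewrite -scalerBl opprB addrA subrK; apply: le_trans (le_enorm_gps_dir _).
  rewrite /t /push !compress_time ?ltr0n// !stair_nat.
  exact: zigzag_step.
- by rewrite /t invr1 subrr.
- by move=> k; rewrite /t ltrD2l ltrN2 ltf_pV2 ?posrE ?ltr0n// ltr_nat.
- by move=> k; rewrite /t gtrBl invr_gt0 ltr0n.
Qed.

(** * The example *)

(** The directions of the two axes are opposite, so both signs of an increment
    along the line are covered. *)
Lemma gps_dir_opp {R : realType} (c : R) :
  c *: gps_dir R (ord0 : 'I_3) = (- c) *: gps_dir R (@Ordinal 3 1 isT).
Proof.
apply/rowP => j; rewrite !mxE.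
by case: ifP => _; rewrite ?mulrN ?mulNr ?mulr1 ?opprK.
Qed.

Theorem theorem3p8 (R : realType) :
  exists psi : R -> 'rV[R]_2,
    [/\ {within `[0, +oo[, continuous psi},
        esp_domain (@gps_normal R) (psi 0) &
        exists phi eta : R -> 'rV[R]_2,
          solves_ESP (@gps_normal R) (@gps_dir R) psi phi eta /\
          exists tau0 : R,
            hitting_time0 phi = tau0%:E /\
            vtotal_variation 0 tau0 eta = +oo%E].
Proof.
pose phi (t : R) := vec2 (xpath t) (ypath t).
pose eta (t : R) := (push t - push 0) *: gps_dir R (ord0 : 'I_3).
have phic : continuous phi.
  by apply: vec2_continuous; [exact: xpath_continuous|exact: ypath_continuous].
have etac : continuous eta.
  move=> t; apply: cvgZr_tmp; apply: cvgB; last exact: cvg_cst.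
  exact: push_continuous.
have eta0 : eta 0 = 0 by rewrite /eta subrr scale0r.
have Gphi t : esp_domain (@gps_normal R) (phi t).
  rewrite gps_domainE => j /=; rewrite mxE.
  by case: ifP => _; [exact: xpath_ge0|exact: ypath_ge0].
exists (phi \- eta); split.
- apply: continuous_subspaceT => t; apply: cvgB; [exact: phic|exact: etac].
- by rewrite /= eta0 subr0.
exists phi, eta; split.
  apply: continuous_solves_ESP => // s t st.
  rewrite /eta -scalerBl opprB addrA subrK.
  have [fall|rise] := ltP (push t) (push s).
    have [u su yu] := push_fall_y0 st fall; exists u => //.
    rewrite gps_dir_opp; apply: esp_dir_face => //.
    + by rewrite inner_vec2 yu mulr0 mul0r addr0.
    + by rewrite inner_vec2; lra.
    + by rewrite opprB subr_ge0 ltW.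
  have [e|ne] := eqVneq (push s) (push t).
    exists t; first by rewrite st lexx.
    by rewrite e subrr scale0r; exact: esp_dir0.
  have [u su xu] : exists2 u : R, s < u <= t & xpath u = 0.
    by apply: push_rise_x0 => //; rewrite lt_neqAle ne.
  exists u => //; apply: esp_dir_face => //.
  + by rewrite inner_vec2 xu mulr0 mul0r addr0.
  + by rewrite inner_vec2; lra.
  + by rewrite subr_ge0.
exists 1; split; last exact: push_variation.
(* before time 1 the coordinates of phi sum to 1 - t, which is not 0 *)
apply/eqP; rewrite eq_le; apply/andP; split.
  apply: ereal_inf_lbound; exists 1 => //; split => //.
  rewrite /phi /xpath /ypath !compress_ge1//.
  by apply/rowP => j; rewrite !mxE; case: ifP.
apply: le_ereal_inf_tmp => _ [t [_ phit0] <-]; rewrite lee_fin leNgt.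
apply/negP => t1; have := xpathDypath t1.
have /rowP xy0 := phit0; have := xy0 0; have := xy0 1; rewrite !mxE /= => -> ->.
lra.
Qed.
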